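(* Let $L_\psi>0$ and let $\phi:\mathbb{R}^N\to\mathbb{R}\cup\{+\infty\}$ be a proper, lower semicontinuous, $\rho$-weakly convex function with $\rho=1-\frac1{L_\psi}$ and with prox-bound $\lambda_\phi>1$. Let $g_b:\mathbb{R}^N\to\mathbb{R}^N$ be an $\epsilon$-type (b) approximation of $\mathrm{prox}_\phi$. Then, for all $x\in\mathbb{R}^N$, $$\|g_b(x)-\mathrm{prox}_\phi(x)\|\le L_\psi\,\epsilon .$$
   Context: $\phi$ is $\rho$-weakly convex if $\phi+\frac{\rho}{2}\|\cdot\|^2$ is convex. The prox-bound $\lambda_\phi$ is the supremum of all $\lambda>0$ such that $\inf_{x}\{\phi(x)+\frac1{2\lambda}\|x-y\|^2\}>-\infty$ for some $y\in\mathbb{R}^N$. The proximal operator is $\mathrm{prox}_\phi(y)=\operatorname{argmin}_{x\in\mathbb{R}^N}\{\phi(x)+\frac12\|x-y\|^2\}$. $g_b$ is an $\epsilon$-type (b) approximation of $\mathrm{prox}_\phi$ if for all $y\in\mathbb{R}^N$ there exists $r(y)\in\mathbb{R}^N$ with $\|r(y)\|\le\epsilon$ and $g_b(y)=\mathrm{prox}_\phi(y+r(y))$. *)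

(* Defs.v *)
From HB Require Import structures.
From mathcomp Require Import all_boot all_order all_algebra.
From mathcomp Require Import all_classical all_reals all_analysis.

Set Implicit Arguments.
Unset Strict Implicit.
Unset Printing Implicit Defensive.

Import Order.TTheory GRing.Theory Num.Theory.
Import numFieldNormedType.Exports.

Local Open Scope classical_set_scope.
Local Open Scope ring_scope.

(* The library norm on 'rV[R]_N is the sup norm, hence this Euclidean one; the
   two norms induce the same topology, so library topological notions apply. *)
Definition enorm (R : realType) (N : nat) (x : 'rV[R]_N) : R :=
  Num.sqrt (\sum_(i < N) x 0 i ^+ 2).

(* A function into R U {+oo} is rendered as one into \bar R that avoids -oo,
   which is part of properness. *)
Definition proper_fun (R : realType) (N : nat) (f : 'rV[R]_N -> \bar R) : Prop :=
  (forall x, f x != -oo%E) /\ (exists x, f x != +oo%E).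

(* Intended for functions avoiding -oo; at t = 0 or t = 1 the convention
   0 * +oo = 0 makes the inequality hold trivially. *)
Definition econvex (R : realType) (N : nat) (f : 'rV[R]_N -> \bar R) : Prop :=
  forall (x y : 'rV[R]_N) (t : R), 0 <= t <= 1 ->
    (f (t *: x + (1 - t) *: y)%R
       <= t%:E * f x + (1 - t)%R%:E * f y)%E.

(* rho may be negative, in which case this is strong convexity. *)
Definition weakly_convex (R : realType) (N : nat) (rho : R)
    (f : 'rV[R]_N -> \bar R) : Prop :=
  econvex (fun x => (f x + (rho / 2 * enorm x ^+ 2)%R%:E)%E).

Definition prox_bound (R : realType) (N : nat) (f : 'rV[R]_N -> \bar R) : \bar R :=
  ereal_sup [set lambda%:E | lambda in
    [set lambda : R | 0 < lambda /\ exists y : 'rV[R]_N,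
      (-oo < ereal_inf
         (range (fun x => f x + ((2 * lambda)^-1 * enorm (x - y) ^+ 2)%R%:E)))%E]].

Definition argmin (T : Type) (R : realType) (F : T -> \bar R) : set T :=
  [set x | forall z, (F x <= F z)%E].

(* Set-valued; "prox f y is the point p" is expressed as prox f y = [set p]. *)
Definition prox (R : realType) (N : nat) (f : 'rV[R]_N -> \bar R)
    (y : 'rV[R]_N) : set 'rV[R]_N :=
  argmin (fun x => (f x + (2^-1 * enorm (x - y) ^+ 2)%R%:E)%E).

Definition type_b_approx (R : realType) (N : nat) (eps : R)
    (f : 'rV[R]_N -> \bar R) (g : 'rV[R]_N -> 'rV[R]_N) : Prop :=
  forall y : 'rV[R]_N, exists2 r : 'rV[R]_N,
    enorm r <= eps & prox f (y + r) = [set g y].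

(* Main.v *)
Require Import Defs.
From HB Require Import structures.
From mathcomp Require Import all_boot all_order all_algebra.
From mathcomp Require Import all_classical all_reals all_analysis.
From mathcomp Require Import ring lra.
Import Order.TTheory GRing.Theory Num.Theory.
Import numFieldNormedType.Exports.
Local Open Scope classical_set_scope.
Local Open Scope ring_scope.

(** Write F_y(z) = phi(z) + |z - y|^2 / 2.  Since phi + (rho/2) |.|^2 is convex
    and 1 - rho = 1/L, the function F_y is strongly convex with modulus 1/L.
    A minimizer p of F_y therefore satisfies the quadratic growth estimate
    F_y(z) >= F_y(p) + |z - p|^2 / (2L) ([prox_growth]).

    Growth makes prox unique and L-Lipschitz: if p minimizes F_x and q minimizes
    F_y, add the estimate for p tested at q to the estimate for q tested at p.
    The values of phi cancel and |q - p|^2 / L <= <q - p, y - x> remains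
    ([prox_lipschitz]).  The claim is this bound with y = x + r(x) and q = g(x).

    The minimizer p of F_x also has to be produced.  The approximation g gives a
    minimizer of F_(x + r(x)), and quadratic growth around it absorbs the linear
    term by which F_x differs from F_(x + r(x)); hence F_x is bounded below
    ([prox_obj_bounded_below]).  By strong convexity at midpoints, the sublevel
    sets of F_x just above its infimum have small diameter.  They generate a
    Cauchy filter, whose limit is a minimizer by lower semicontinuity
    ([prox_exists]). *)

(** * Euclidean inner product on row vectors *)

Section InnerProduct.
Set Implicit Arguments.
Unset Strict Implicit.
Variables (R : realType) (N : nat).
Implicit Types (u v w x y z : 'rV[R]_N) (t : R).

Definition dot u v : R := \sum_(i < N) u 0 i * v 0 i.

Lemma enorm_sqr u : enorm u ^+ 2 = dot u u.
Proof.
rewrite /enorm sqr_sqrtr; last by apply: sumr_ge0 => i _; exact: sqr_ge0.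
by apply: eq_bigr => i _; rewrite expr2.
Qed.

Lemma enorm_ge0 u : 0 <= enorm u.
Proof. exact: sqrtr_ge0. Qed.

Lemma dot_ge0 u : 0 <= dot u u.
Proof. by rewrite -enorm_sqr sqr_ge0. Qed.

Lemma dotC u v : dot u v = dot v u.
Proof. by apply: eq_bigr => i _; rewrite mulrC. Qed.

Lemma dotDl u v w : dot (u + v) w = dot u w + dot v w.
Proof. by rewrite -big_split; apply: eq_bigr => i _; rewrite mxE mulrDl. Qed.

Lemma dotZl t u w : dot (t *: u) w = t * dot u w.
Proof. by rewrite mulr_sumr; apply: eq_bigr => i _; rewrite mxE mulrA. Qed.

Lemma dotNl u w : dot (- u) w = - dot u w.
Proof. by rewrite -scaleN1r dotZl mulN1r. Qed.

Lemma dotDr u v w : dot w (u + v) = dot w u + dot w v.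
Proof. by rewrite dotC dotDl !(dotC w). Qed.

Lemma dotZr t u w : dot w (t *: u) = t * dot w u.
Proof. by rewrite dotC dotZl (dotC w). Qed.

Lemma dotNr u w : dot w (- u) = - dot w u.
Proof. by rewrite dotC dotNl (dotC w). Qed.

(** Expanding squared distances with these rules turns the identities behind
    strong convexity into (in)equalities linear in the inner products. *)
Definition dotE := (dotDl, dotDr, dotNl, dotNr, dotZl, dotZr).

Lemma dot_eq0 u : dot u u = 0 -> u = 0.
Proof.
move=> /eqP; rewrite psumr_eq0; last by move=> i _; rewrite -expr2 sqr_ge0.
move=> /allP u0; apply/rowP => i; rewrite mxE.
have /= := u0 i (mem_index_enum i).
by rewrite mulf_eq0 orbb => /eqP.
Qed.

(** The norm [`|u|] is the sup norm, which the Euclidean one dominates; this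
    transfers small Euclidean diameters to the uniform structure of 'rV[R]_N. *)
Lemma normr_lt_dot u t : 0 < t -> dot u u < t ^+ 2 -> `|u| < t.
Proof.
move=> t0 ut; rewrite [ltLHS]/Num.Def.normr /= mx_normrE.
apply: bigmax_lt => // -[i j] _ /=; rewrite (ord1 i) -ltr_sqr ?nnegrE ?(ltW t0)//.
rewrite real_normK ?num_real//; apply: le_lt_trans ut.
rewrite /dot (bigD1 j) //= -expr2 lerDl.
by apply: sumr_ge0 => k _; rewrite -expr2 sqr_ge0.
Qed.

Lemma dot_cvg y z : dot (u - y) (u - y) @[u --> z] --> dot (z - y) (z - y).
Proof.
rewrite /dot.
have FF : Filter (nbhs z) := nbhs_filter z.
apply: (cvg_big (@add_continuous _)) => i _.
have c : (u - y) 0 i @[u --> z] --> (z - y) 0 i.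
  rewrite !mxE; under eq_fun do rewrite !mxE.
  by apply: cvgB (@coord_continuous R 1 N 0 i z) (cvg_cst _).
exact: (cvgM c c).
Qed.

End InnerProduct.

(** * Proximal map of a weakly convex function *)

Section ProximalMap.
Set Implicit Arguments.
Unset Strict Implicit.
Variables (R : realType) (N : nat) (L : R) (phi : 'rV[R]_N -> \bar R).
Hypothesis L_gt0 : 0 < L.
Hypothesis phi_proper : proper_fun phi.
Hypothesis phi_wcvx : weakly_convex (1 - L^-1) phi.
Implicit Types (u v x y z p q : 'rV[R]_N) (a b c t : R).

Local Notation sqn u := (dot u u).

(** The quadratic added to phi turns its weak convexity defect rho/2 into the
    gain (1 - rho)/2 = 1/(2L), whatever the centre y, because changing y
    alters the objective by an affine function only. *)
Lemma prox_obj_strongly_convex y u v t a b :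
  0 <= t <= 1 -> phi u = a%:E -> phi v = b%:E ->
  exists2 c, phi (t *: u + (1 - t) *: v) = c%:E &
    c + 2^-1 * sqn (t *: u + (1 - t) *: v - y)
      <= t * (a + 2^-1 * sqn (u - y)) + (1 - t) * (b + 2^-1 * sqn (v - y))
         - t * (1 - t) * ((2 * L)^-1 * sqn (u - v)).
Proof.
move=> t01 ua vb; have := phi_wcvx u v t01.
rewrite /= ua vb; have := phi_proper.1 (t *: u + (1 - t) *: v).
case E: (phi _) => [c| |] //= _ cvx; exists c => //; move: cvx.
rewrite -!EFinD lee_fin !enorm_sqr !dotE.
rewrite !(dotC v u) !(dotC y).
have -> : (2 * L)^-1 = L^-1 / 2 by rewrite invfM mulrC.
by move: L^-1 => k; lra.
Qed.

Lemma prox_proper y p : prox phi y p -> exists a, phi p = a%:E.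
Proof.
have [phiN [z]] := phi_proper => zoo /(_ z); have := phiN p; have := phiN z.
case: (phi z) zoo => [c| |] //= _ _.
by case: (phi p) => [a| |] //= _ _; exists a.
Qed.

(** The minimality of p on the segment from p to z bounds the growth by
    1 - t times the full quadratic term; let t tend to 0. *)
Lemma prox_growth y p z a c :
  prox phi y p -> phi p = a%:E -> phi z = c%:E ->
  a + 2^-1 * sqn (p - y) + (2 * L)^-1 * sqn (z - p) <= c + 2^-1 * sqn (z - y).
Proof.
move=> py pa zc.
set Fp := a + _; set Fz := c + _; set D := _ * sqn (z - p).
have D_ge0 : 0 <= D by rewrite mulr_ge0 ?dot_ge0// invr_ge0 mulr_ge0// ltW.
have seg t : 0 < t -> t <= 1 -> Fp + (1 - t) * D <= Fz.
  move=> t0 t1; have t01 : 0 <= t <= 1 by rewrite ltW.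
  have [b wb] := prox_obj_strongly_convex y t01 zc pa.
  have := py (t *: z + (1 - t) *: p).
  rewrite /= wb pa -!EFinD lee_fin !enorm_sqr -/Fp -/Fz -/D => h1 h2.
  have h3 : t * (Fp + (1 - t) * D) <= t * Fz by lra.
  by rewrite ler_pM2l in h3.
apply/ler_addgt0Pr => e e0.
have d0 : 0 < D + e by lra.
have /(_ _ _)/= := seg (e / (D + e)).
rewrite divr_gt0// ler_pdivrMr// => /(_ isT).
have h : e / (D + e) * D <= e.
  by rewrite mulrAC ler_pdivrMr// ler_wpM2l//; lra.
by move=> H; have := H ltac:(lra); lra.
Qed.

Lemma prox_lipschitz x y p q :
  prox phi x p -> prox phi y q -> enorm (q - p) <= L * enorm (y - x).
Proof.
move=> xp yq; have [a pa] := prox_proper xp; have [b qb] := prox_proper yq.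
have hp := prox_growth xp pa qb; have hq := prox_growth yq qb pa.
have mono : sqn (q - p) <= L * dot (q - p) (y - x).
  have : L^-1 * sqn (q - p) <= dot (q - p) (y - x).
    move: hp hq; rewrite invfM !dotE !(dotC q p) !(dotC x) !(dotC y).
    by move: L^-1 => k; lra.
  by rewrite ler_pdivrMl.
rewrite -ler_sqr ?nnegrE ?mulr_ge0 ?enorm_ge0 ?(ltW L_gt0)//.
rewrite exprMn !enorm_sqr.
(* 2 <d, L e> <= |d|^2 + |L e|^2 with d = q - p and e = y - x. *)
have := dot_ge0 (q - p - L *: (y - x)).
move: mono; move: (q - p) (y - x) => d e.
by rewrite !dotE (dotC e d); lra.
Qed.

Lemma prox_unique y p q : prox phi y p -> prox phi y q -> p = q.
Proof.
move=> yp yq; have := prox_lipschitz yq yp.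
rewrite subrr => h; apply/eqP; rewrite -subr_eq0; apply/eqP.
apply: dot_eq0; rewrite -enorm_sqr.
suff -> : enorm (p - q) = 0 by rewrite expr0n.
apply/eqP; rewrite eq_le enorm_ge0 andbT; apply: le_trans h _.
by rewrite -[enorm 0]/(Num.sqrt _) big1 ?sqrtr0 ?mulr0// => i _; rewrite mxE expr0n.
Qed.

(** A minimizer for one centre bounds the objective below for every centre: the
    two objectives differ by an affine function, which quadratic growth
    dominates. *)
Lemma prox_obj_bounded_below x y q :
  prox phi y q ->
  exists m, forall z c, phi z = c%:E -> m <= c + 2^-1 * sqn (z - x).
Proof.
move=> yq; have [b qb] := prox_proper yq.
(* The minimum over w = z - q of |w|^2 / (2L) + <w, y - x> is reached at
   w = - L (y - x), where it equals - L |y - x|^2 / 2. *)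
exists (b + 2^-1 * sqn (q - x) - L / 2 * sqn (y - x)) => z c zc.
have grow := prox_growth yq qb zc.
have := dot_ge0 (z - q + L *: (y - x)).
have -> : sqn (z - q + L *: (y - x)) =
    sqn (z - q) + 2 * L * dot (z - q) (y - x) + L ^+ 2 * sqn (y - x).
  by move: (z - q) (y - x) => d e; rewrite !dotE (dotC e d); ring.
move=> h0.
have h : 0 <= (2 * L)^-1 * sqn (z - q) + dot (z - q) (y - x) + L / 2 * sqn (y - x).
  have L2 : 0 < 2 * L by rewrite mulr_gt0.
  rewrite -(pmulr_rge0 _ L2); move: h0; congr (_ <= _); field.
  by rewrite gt_eqF.
move: grow h; move: ((2 * L)^-1 * _) (L / 2 * _) => k l.
by rewrite !dotE !(dotC z) !(dotC x) !(dotC y); lra.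
Qed.

Definition prox_sublevel x m : set 'rV[R]_N :=
  [set z | exists2 c, phi z = c%:E & c + 2^-1 * sqn (z - x) <= m].

(** The midpoint of two points of the sublevel set at height m + e still has
    objective at least m, so strong convexity leaves room for a distance of
    order sqrt e only. *)
Lemma prox_sublevel_diam x m e u v :
  (forall z c, phi z = c%:E -> m <= c + 2^-1 * sqn (z - x)) ->
  prox_sublevel x (m + e) u -> prox_sublevel x (m + e) v ->
  sqn (u - v) <= 8 * L * e.
Proof.
move=> lb [a ua ha] [b vb hb].
have t01 : 0 <= (2^-1 : R) <= 1 by apply/andP; split; lra.
have [c wc hc] := prox_obj_strongly_convex x t01 ua vb.
have hm : 2^-1 * (1 - 2^-1) * ((2 * L)^-1 * sqn (u - v)) <= e.
  by have := lb _ _ wc; lra.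
have -> : sqn (u - v) =
    8 * L * (2^-1 * (1 - 2^-1) * ((2 * L)^-1 * sqn (u - v))).
  by field; rewrite gt_eqF.
by rewrite ler_wpM2l// mulr_ge0// ltW.
Qed.

(** The sublevel sets at heights m + e, with m the infimum of the objective and
    e > 0, generate a proper filter.  It is Cauchy because their diameters tend
    to 0, and lower semicontinuity puts the limit at height m. *)
Lemma prox_exists x m0 :
  lower_semicontinuous phi ->
  (forall z c, phi z = c%:E -> m0 <= c + 2^-1 * sqn (z - x)) ->
  exists p, prox phi x p.
Proof.
move=> phi_lsc lb0.
pose A := [set v | exists z c, phi z = c%:E /\ v = c + 2^-1 * sqn (z - x)].
have A_inf : has_inf A.
  split; last by exists m0 => _ [z [c [zc ->]]]; exact: lb0 zc.
  have [phiN [z zoo]] := phi_proper; have := phiN z.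
  case zc: (phi z) zoo => [c| |] //= _ _.
  by exists (c + 2^-1 * sqn (z - x)), z, c.
pose m := inf A.
have lb z c : phi z = c%:E -> m <= c + 2^-1 * sqn (z - x).
  by move=> zc; apply: ge_inf; [exact: A_inf.2 | exists z, c].
have sub_neq0 e : 0 < e -> prox_sublevel x (m + e) !=set0.
  move=> e0; have [_ [z [c [zc ->]]] /ltW ze] := inf_adherent e0 A_inf.
  by exists z, c.
pose F := filter_from [set e : R | 0 < e] (fun e => prox_sublevel x (m + e)).
have FF : ProperFilter F.
  apply: filter_from_proper => [|e e0]; last exact: sub_neq0.
  apply: filter_from_filter; first by exists 1; exact: ltr01.
  move=> d e d0 e0; exists (Num.min d e); first by rewrite /= lt_min d0.
  move=> z [c zc]; rewrite -lerBlDl le_min !lerBlDl => /andP[zd ze].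
  by split; exists c.
have /cauchy_cvg Fcvg : cauchy F.
  apply: cauchy_exP => e e0.
  (* By the diameter bound this height gives |u - v|^2 <= e^2 / 2 < e^2. *)
  have d0 : 0 < e ^+ 2 / (16 * L) by rewrite divr_gt0 ?exprn_gt0// mulr_gt0.
  have [u us] := sub_neq0 _ d0.
  exists u; exists (e ^+ 2 / (16 * L)) => // v vs.
  rewrite -ball_normE /=; apply: normr_lt_dot => //.
  apply: le_lt_trans (prox_sublevel_diam lb us vs) _.
  have -> : 8 * L * (e ^+ 2 / (16 * L)) = e ^+ 2 / 2.
    by field; rewrite gt_eqF.
  by have := exprn_gt0 2 e0; lra.
pose p := lim F.
exists p => z /=; rewrite !enorm_sqr.
have := phi_proper.1 z; case zc: (phi z) => [c| |] //= _; last first.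
  by rewrite addye// leey.
suff pm : (phi p <= (m - 2^-1 * sqn (p - x))%:E)%E.
  apply: le_trans (leeD2r _ pm) _.
  by rewrite -!EFinD lee_fin subrK; exact: lb.
apply/lee_addgt0Pr => e e0; rewrite leNgt; apply/negP; rewrite -EFinD.
move=> /phi_lsc[V pV phiV].
(* F contains V, where phi exceeds m - |p - x|^2 / 2 + e, but also the set where
   |z - x|^2 is within e of |p - x|^2 from below and the sublevel set at height
   m + e / 2: a common point contradicts the choice of V. *)
have e2 : 0 < e / 2 by rewrite divr_gt0.
have Vp : F V by exact: Fcvg.
have Wp : F [set z | sqn (p - x) - e < sqn (z - x)].
  apply: Fcvg; have := @dot_cvg _ _ x p => /cvgr_gt; apply.
  by rewrite ltrBlDr ltrDl.
have Sp : F (prox_sublevel x (m + e / 2)) by exists (e / 2).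
have [w [[Vw Ww] [b wb bw]]] := filter_ex (filterI (filterI Vp Wp) Sp).
by have := phiV w Vw; rewrite wb lte_fin; move: Ww bw => /=; lra.
Qed.

End ProximalMap.

Theorem proposition5 (R : realType) (N : nat) (L eps : R)
    (phi : 'rV[R]_N -> \bar R) (g : 'rV[R]_N -> 'rV[R]_N)
    (L_gt0 : 0 < L)
    (phi_proper : proper_fun phi)
    (phi_lsc : lower_semicontinuous phi)
    (phi_weakly_convex : weakly_convex (1 - L^-1) phi)
    (phi_prox_bound : (1%:E < prox_bound phi)%E)
    (g_approx : type_b_approx eps phi g) :
  forall x : 'rV[R]_N,
    exists2 p : 'rV[R]_N, prox phi x = [set p] & enorm (g x - p) <= L * eps.
Proof.
move=> x; have [r r_eps prox_xr] := g_approx x.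
have gx : prox phi (x + r) (g x) by rewrite prox_xr.
have [m lb] := prox_obj_bounded_below L_gt0 phi_proper phi_weakly_convex x gx.
have [p px] := prox_exists L_gt0 phi_proper phi_weakly_convex phi_lsc lb.
exists p.
  apply/seteqP; split=> [q qx | _ ->//].
  exact: (prox_unique L_gt0 phi_proper phi_weakly_convex qx px).
have := prox_lipschitz L_gt0 phi_proper phi_weakly_convex px gx.
rewrite (addrC x) addrK => /le_trans; apply.
by rewrite ler_wpM2l// ltW.
Qed.
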